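(* Let $\Sigma_{\mathcal{F}}$ be an irreducible subshift of finite type over $\Sigma=\{0,1,\dots,q-1\}$ with $\mathcal{F}=\{a_1,\dots,a_s\}$ a minimal collection of forbidden words whose longest word has length $p\ge 2$, let $A$ be its adjacency matrix and $\theta$ the Perron root of $A$. Let $v=(v_x)_x$ and $u=(u_x)_x$ be the vectors indexed by the allowed words $x$ of length $p-1$ and defined by \[ u_x=1-\sum_{i=1}^s \mathcal{R}_i(\theta)\,(\widetilde{a_i},x)_\theta,\qquad v_x=1-\sum_{j=1}^s\mathcal{C}_j(\theta)\,(x,a_j)_\theta . \] Then $u_xv_x>0$ for each allowed word $x$ of length $p-1$. Moreover, $v$ and $u$ are right and left Perron eigenvectors, respectively, of $A$ (corresponding to the eigenvalue $\theta$). Further, if $\theta>1$, then \[ u^Tv=\theta^{p-1}\left(1+r'(\theta)\right). \]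
   Context: Let $q\ge 2$ and $\Sigma=\{0,1,\dots,q-1\}$. For a finite collection $\mathcal{F}$ of words over $\Sigma$ (each of length at least two), $\Sigma_{\mathcal{F}}\subset\Sigma^{\mathbb{N}}$ is the set of one-sided sequences containing no word of $\mathcal{F}$ as a (contiguous) subword. A word is allowed in $\Sigma_{\mathcal{F}}$ if it appears as a subword of some sequence in $\Sigma_{\mathcal{F}}$. The (non-empty) collection $\mathcal{F}=\{a_1,\dots,a_s\}$ of distinct words is minimal if all proper subwords of the words in $\mathcal{F}$ are allowed. Let $p\ge 2$ be the length of the longest word in $\mathcal{F}$. Adjacency matrix: $A$ is the $(0,1)$ matrix with rows and columns indexed by the allowed words of length $p-1$ (in lexicographic order), whose entry at $(x_1\dots x_{p-1},\,y_1\dots y_{p-1})$ is $1$ if and only if $x_2\dots x_{p-1}=y_1\dots y_{p-2}$ (no condition if $p=2$) and $x_1\dots x_{p-1}y_{p-1}$ is an allowed word of length $p$. $\Sigma_{\mathcal{F}}$ is irreducible if $A$ is irreducible, i.e. for all $i,j$ there is $\ell\ge1$ with $(A^\ell)_{ij}>0$. The Perron root $\theta$ of $A$ is its spectral radius (an eigenvalue of $A$). For irreducible $A$, a right (left) Perron eigenvector is a right (left) eigenvector for $\theta$ with all entries positive; left eigenvectors are written as columns $u$ with $u^TA=\theta u^T$. Correlation: for words $x=x_1\dots x_{p_1}$ and $y=y_1\dots y_{p_2}$, the correlation polynomial is $(x,y)_z=\sum_{\ell=0}^{p_1-1}b_\ell z^{p_1-1-\ell}$, where $b_\ell=1$ if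 $x_{\ell+k}=y_k$ for all $1\le k\le \min(p_1-\ell,p_2)$, and $b_\ell=0$ otherwise; $(x,y)_\theta$ is its value at $z=\theta$. The correlation matrix of $\mathcal{F}$ is $\mathcal{M}(z)=[(a_j,a_i)_z]_{1\le i,j\le s}$ (the $(i,j)$ entry is $(a_j,a_i)_z$); its determinant is a non-zero polynomial. The rational function $r(z)$ is the sum of all entries of $\mathcal{M}(z)^{-1}$; $\mathcal{R}_i(z)$ is the sum of the entries of the $i$th row and $\mathcal{C}_j(z)$ the sum of the entries of the $j$th column of $\mathcal{M}(z)^{-1}$. Values at $\theta$ are understood as limits: $\mathcal{R}_i(\theta)=\lim_{z\to\theta}\mathcal{R}_i(z)$, $\mathcal{C}_j(\theta)=\lim_{z\to\theta}\mathcal{C}_j(z)$, and $r'(\theta)$ is the derivative at $\theta$ of $r$ with any removable singularity removed. $\widetilde{a_i}$ is the word obtained from $a_i$ by removing its first symbol. *)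

(* Defs.v *)
From mathcomp Require Import all_boot all_order all_algebra.
From mathcomp Require Import all_classical all_reals all_analysis.
From mathcomp Require Import complex.
Import Order.TTheory GRing.Theory Num.Theory.
Import numFieldNormedType.Exports.

Set Implicit Arguments.
Unset Strict Implicit.
Unset Printing Implicit Defensive.

Local Open Scope classical_set_scope.
Local Open Scope ring_scope.

(* Words over the alphabet {0, ..., q-1} are sequences in [seq 'I_q]; the
   collection of forbidden words is a family [a : 'I_s -> seq 'I_q]. *)

Definition occurs (q : nat) (w : seq 'I_q) (x : nat -> 'I_q) : Prop :=
  exists n : nat, w = mkseq (fun k => x (n + k)%N) (size w).

Definition sft (q s : nat) (a : 'I_s -> seq 'I_q) : set (nat -> 'I_q) :=
  [set x | forall i, ~ occurs (a i) x].

Definition allowed (q s : nat) (a : 'I_s -> seq 'I_q) (w : seq 'I_q) : Prop :=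
  exists2 x, sft a x & occurs w x.

Definition minimal_collection (q s : nat) (a : 'I_s -> seq 'I_q) : Prop :=
  forall (i : 'I_s) (w : seq 'I_q),
    infix w (a i) -> w != a i -> allowed a w.

Definition max_length (q s : nat) (a : 'I_s -> seq 'I_q) : nat :=
  \max_(i < s) size (a i).

Definition allowed_words (q s : nat) (a : 'I_s -> seq 'I_q) (n : nat) :
    {set n.-tuple 'I_q} :=
  [set w : n.-tuple 'I_q | `[< allowed a w >]].

(* The number of states, i.e., of allowed words of length p-1 where
   p = [max_length a]. *)
Definition nstates (q s : nat) (a : 'I_s -> seq 'I_q) : nat :=
  #|allowed_words a (max_length a).-1|.

(* The i-th state; [enum] lists tuples of ordinals in lexicographic order. *)
Definition state (q s : nat) (a : 'I_s -> seq 'I_q) (i : 'I_(nstates a)) :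
    (max_length a).-1.-tuple 'I_q :=
  enum_val i.

(* With p = [max_length a] and x, y of length p-1, [take p.-2 y] is
   y_1 ... y_(p-2), and [drop p.-2 y] is the one-letter word y_(p-1). *)
Definition adjacency (R : realType) (q s : nat) (a : 'I_s -> seq 'I_q) :
    'M[R]_(nstates a) :=
  let p := max_length a in
  \matrix_(i, j)
    ((behead (state i) == take p.-2 (state j)) &&
     `[< allowed a (state i ++ drop p.-2 (state j)) >])%:R.

Definition irreducible_mx (R : realType) (n : nat) (A : 'M[R]_n) : Prop :=
  forall i j : 'I_n, exists2 l : nat, (1 <= l)%N & 0 < (A ^+ l) i j.

Definition spectral_radius (R : realType) (n : nat) (A : 'M[R]_n) : R :=
  sup [set ComplexField.Normc.normc z
      | z in [set z : R[i] | eigenvalue (map_mx (real_complex R) A) z]].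

Definition right_perron_vector (R : realType) (n : nat) (A : 'M[R]_n)
    (v : 'cV[R]_n) : Prop :=
  A *m v = spectral_radius A *: v /\ forall i, 0 < v i 0.

Definition left_perron_vector (R : realType) (n : nat) (A : 'M[R]_n)
    (u : 'cV[R]_n) : Prop :=
  u^T *m A = spectral_radius A *: u^T /\ forall i, 0 < u i 0.

(* Letters are numbered from 0 here, so [x_(l+k) = y_k] for
   1 <= k <= min(|x| - l, |y|) becomes a condition on 0 <= k < min(...). *)
Definition overlap (q : nat) (x y : seq 'I_q) (l : nat) : bool :=
  [forall k : 'I_(minn (size x - l) (size y)), onth x (l + k) == onth y k].

Definition corr (R : realType) (q : nat) (x y : seq 'I_q) : {poly R} :=
  \sum_(l < size x) (overlap x y l)%:R *: 'X^(size x - 1 - l).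

Definition corr_mx (R : realType) (q s : nat) (a : 'I_s -> seq 'I_q) :
    'M[{poly R}]_s :=
  \matrix_(i, j) corr R (a j) (a i).

(* The rational matrix M(z)^-1 is represented by its values at real points z.
   Where det M(z) = 0 the value is junk; these points are finitely many, and
   [regularized] below never uses the value of a function at the point itself. *)
Definition corr_inv (R : realType) (q s : nat) (a : 'I_s -> seq 'I_q) (z : R) :
    'M[R]_s :=
  invmx (map_mx (fun f : {poly R} => f.[z]) (corr_mx R a)).

Definition row_sum (R : realType) (q s : nat) (a : 'I_s -> seq 'I_q)
    (i : 'I_s) (z : R) : R :=
  \sum_(j < s) corr_inv a z i j.

Definition col_sum (R : realType) (q s : nat) (a : 'I_s -> seq 'I_q)
    (j : 'I_s) (z : R) : R :=
  \sum_(i < s) corr_inv a z i j.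

Definition total_sum (R : realType) (q s : nat) (a : 'I_s -> seq 'I_q)
    (z : R) : R :=
  \sum_(i < s) \sum_(j < s) corr_inv a z i j.

(* A rational function with its removable singularities removed. *)
Definition regularized (R : realType) (f : R -> R) (t : R) : R :=
  lim (f z @[z --> t^']).

Definition u_coord (R : realType) (q s : nat) (a : 'I_s -> seq 'I_q)
    (theta : R) (x : seq 'I_q) : R :=
  1 - \sum_(i < s)
        regularized (row_sum a i) theta * (corr R (behead (a i)) x).[theta].

Definition v_coord (R : realType) (q s : nat) (a : 'I_s -> seq 'I_q)
    (theta : R) (x : seq 'I_q) : R :=
  1 - \sum_(j < s)
        regularized (col_sum a j) theta * (corr R x (a j)).[theta].

Definition u_vec (R : realType) (q s : nat) (a : 'I_s -> seq 'I_q)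
    (theta : R) : 'cV[R]_(nstates a) :=
  \col_k u_coord a theta (state k).

Definition v_vec (R : realType) (q s : nat) (a : 'I_s -> seq 'I_q)
    (theta : R) : 'cV[R]_(nstates a) :=
  \col_k v_coord a theta (state k).

(* Main.v *)
Require Import Defs.
From mathcomp Require Import all_boot all_order all_algebra.
From mathcomp Require Import all_classical all_reals all_analysis.
From mathcomp Require Import complex ring lra.
Import Order.TTheory GRing.Theory Num.Theory.
Import numFieldNormedType.Exports.

(** Where the correlation matrix M(z) is invertible, let C_j(z) be the column
sums of its inverse and put V_x(z) = 1 - sum_j C_j(z) (x, a_j)_z for every
finite word x. Two facts drive the proof. If x ends with a forbidden word,
then V_x(z) = 0, because the C_j solve the system
sum_j C_j(z) (a_k, a_j)_z = 1 ([weight_suffix]). If x contains no forbidden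
word, then the sum of V_xe(z) over all letters e is z V_x(z) - delta(z), where
delta(z) = z - q + r(z), because each overlap of x with a forbidden word is
continued by exactly one letter ([sum_weight_rcons]). On words of length p - 1
this says A V(z) = z V(z) - delta(z) 1 ([adjacency_weight]). Starting from the
empty word, of weight 1, it also shows that the weights of the words of length
n that contain no forbidden word sum to z^n whenever delta(z) = 0
([sum_avoids_weight]).

At the Perron root theta, A has a positive left eigenvector
([irreducible_perron]). Pairing it with the relation above gives
delta(theta) = 0 ([defect_spectral_radius]), so V(theta) is an eigenvector whose
entries sum to theta^(p-1) > 0. Eigenvectors for theta have constant sign
([perron_eigenvector_sign]), hence V(theta) > 0. The same argument shows that
M(theta) is invertible: a row vector c with c M(theta) = 0 produces, with the
constant 1 replaced by 0, an eigenvector whose entries sum to 0. It is therefore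
zero, and going back from words of length p - 1 to shorter words gives c = 0
([corr_mx_unit_spectral_radius]). So the limits at theta are plain values.

Reversing all words exchanges rows and columns of M and turns V into U, which
settles the left eigenvector ([adjacency_weight_rev]). Finally, pairing the
relation for V(z) with the left eigenvector U = U(theta), whose entries sum to
theta^(p-1), gives (z - theta) U^T V(z) = theta^(p-1) delta(z)
([near_total_sum]). Dividing by z - theta and letting z tend to theta yields
U^T V(theta) = theta^(p-1) delta'(theta) = theta^(p-1) (1 + r'(theta)).

Minimality of the collection makes the shift non-empty, prevents a forbidden
word from containing another one ([minimal_antichain]), and ensures that every
word that contains no forbidden word extends to a sequence of the shift
([avoids_allowed]), so that the states are all the words of length p - 1 that
contain no forbidden word. *)

Set Implicit Arguments.
Unset Strict Implicit.
Unset Printing Implicit Defensive.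
Local Open Scope classical_set_scope.
Local Open Scope ring_scope.

(** * Overlap polynomials of words *)

Section Overlaps.
Context {R : comNzRingType} {T : eqType}.
Implicit Types (z : R) (x y t : seq T).

(** The correlation polynomial, indexed by the length [m.+1] of the overlap
rather than by its position in [x]. An occurrence of [y] that ends before
[x] does is not counted, which makes the definition symmetric under reversal; on
the words that matter the two polynomials agree. *)
Definition overlap_sum z x y : R :=
  \sum_(m < size y) (suffix (take m.+1 y) x)%:R * z ^+ m.

(** Both sides say that [x] ends, and [y] begins, with the same [m] letters. *)
Lemma suffix_take_prefix_drop x y m : (m <= size x)%N ->
  (m <= size y)%N && suffix (take m y) x = prefix (drop (size x - m) x) y.
Proof.
move=> mx; apply/andP/idP => [[my]|].
  rewrite suffixE size_takel // => /eqP ->; exact: prefix_take.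
move=> p; have sd : size (drop (size x - m) x) = m by rewrite size_drop subKn.
have := size_prefix p; rewrite sd => my; split=> //.
by move: p; rewrite prefixE sd => /eqP ->; exact: suffix_drop.
Qed.

Lemma overlap_sum_widen z x y n : (size y <= n)%N ->
  overlap_sum z x y =
  \sum_(m < n | (m < size y)%N) (suffix (take m.+1 y) x)%:R * z ^+ m.
Proof.
move=> le_yn; rewrite /overlap_sum.
by rewrite (big_ord_widen _
  (fun m => (suffix (take m.+1 y) x)%:R * z ^+ m) le_yn).
Qed.

(** The bound on the overlap length may be taken from either word: an overlap
is no longer than the shorter of the two. *)
Lemma overlap_sum_size z x y : overlap_sum z x y =
  \sum_(m < size x | prefix (drop (size x - m.+1) x) y) z ^+ m.
Proof.
rewrite (overlap_sum_widen z x (leq_maxr (size x) (size y))).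
rewrite (big_ord_widen_cond _ (fun m => prefix (drop (size x - m.+1) x) y)
  (fun m => z ^+ m) (leq_maxl (size x) (size y))).
rewrite big_mkcond [RHS]big_mkcond; apply: eq_bigr => m _.
have [mx|xm] := ltnP m (size x); last first.
  rewrite andbF; case: ltnP => // my.
  case: (boolP (suffix _ _)) => [/size_suffix|].
    by rewrite size_takel // ltnNge xm.
  by rewrite mul0r.
rewrite andbT -suffix_take_prefix_drop //.
by case: ltnP => //= _; case: suffix; rewrite ?mul1r ?mul0r.
Qed.

(** Reversal exchanges suffixes and prefixes. This is what turns statements
about right eigenvectors into statements about left eigenvectors. *)
Lemma overlap_sum_rev z x y :
  overlap_sum z (rev y) (rev x) = overlap_sum z x y.
Proof.
rewrite overlap_sum_size /overlap_sum size_rev big_mkcond /=.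
apply: eq_bigr => m _; rewrite drop_rev subKn // prefix_rev.
by case: suffix; rewrite ?mul1r ?mul0r.
Qed.

Lemma overlap_sum0x z y : overlap_sum z [::] y = 0.
Proof. by rewrite overlap_sum_size big_ord0. Qed.

Lemma overlap_sum_rconsr z x y c : overlap_sum z x (rcons y c) =
  overlap_sum z x y + (suffix (rcons y c) x)%:R * z ^+ size y.
Proof.
rewrite /overlap_sum size_rcons big_ord_recr /= -(size_rcons y c) take_size.
congr (_ + _); apply: eq_bigr => m _.
by rewrite -cats1 takel_cat.
Qed.

Lemma overlap_sum_consl z x y e : overlap_sum z (e :: x) y =
  overlap_sum z x y + (prefix (e :: x) y)%:R * z ^+ size x.
Proof.
rewrite !overlap_sum_size /= big_mkcond big_ord_recr /= subnn drop0.
congr (_ + _); last by case: prefix; rewrite ?mul1r ?mul0r.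
by rewrite [RHS]big_mkcond; apply: eq_bigr => m _; rewrite (subSn (ltn_ord m)).
Qed.

Lemma suffix_suffix_le t x y :
  suffix t y -> suffix x y -> (size t <= size x)%N -> suffix t x.
Proof.
move=> ty /suffixP[w yE] le_tx; move: ty; rewrite yE !suffixE size_cat.
by rewrite -addnBA // drop_cat ltnNge leq_addr /= addKn.
Qed.

End Overlaps.

Section OverlapFin.
Context {R : comNzRingType} {T : finType}.

(** The last letter of a nonempty overlap of [rcons x c] with [y] is the letter
[c], and exactly one [c] continues a given overlap of [x]. So summing over [c]
turns an overlap of length [m] into one of length [m.+1], the empty overlap
giving the constant [1]; the only overlap that cannot be continued is [y]
itself. *)
Lemma sum_overlap_sum_rcons (z : R) (x y : seq T) :
  y != [::] -> ~~ suffix y x ->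
  \sum_c overlap_sum z (rcons x c) y = 1 + z * overlap_sum z x y.
Proof.
case: y => // b y _ nyx; rewrite /overlap_sum exchange_big.
(* Summing over the appended letter leaves the overlap without its last
   letter, possibly empty. *)
transitivity (\sum_(m < (size y).+1) (suffix (take m (b :: y)) x)%:R * z ^+ m).
  apply: eq_bigr => m _; rewrite -mulr_suml; congr (_ * _).
  rewrite -natr_sum; congr _%:R.
  under eq_bigr => c _ do
    rewrite (take_nth b (ltn_ord m : (m < size (b :: y))%N)) suffix_rcons.
  rewrite (bigD1 (nth b (b :: y) m)) //= eqxx big1 ?addn0 // => c.
  by rewrite eq_sym => /negbTE ->.
rewrite big_ord_recl take0 suffix0s expr0 mulr1; congr (_ + _).
rewrite big_ord_recr (take_size (b :: y)) (negbTE nyx) mul0r /= addr0 mulr_sumr.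
by apply: eq_bigr => m _; rewrite /bump exprS mulrCA.
Qed.

End OverlapFin.

(** * Weights of words *)

Section Tuples.
Context {V : nmodType} {T : finType}.

Lemma sum_tuple_rcons n (G : seq T -> V) :
  \sum_(w : n.+1.-tuple T) G w =
  \sum_(x : n.-tuple T) \sum_c G (rcons x c).
Proof.
rewrite pair_big /=.
rewrite (reindex (fun u : n.-tuple T * T => [tuple of rcons u.1 u.2])) //=.
apply: onW_bij; apply: inj_card_bij; last first.
  by rewrite card_prod !card_tuple expnSr.
move=> [x b] [y c] /(congr1 val) /= /rcons_inj [xy ->].
by congr (_, _); apply: val_inj.
Qed.

Lemma sum_tuple_cons n (G : seq T -> V) :
  \sum_(w : n.+1.-tuple T) G w =
  \sum_(x : n.-tuple T) \sum_c G (c :: x).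
Proof.
rewrite pair_big /=.
rewrite (reindex (fun u : n.-tuple T * T => [tuple of u.2 :: u.1])) //=.
apply: onW_bij; apply: inj_card_bij; last first.
  by rewrite card_prod !card_tuple expnSr.
move=> [x b] [y c] /(congr1 val) /= [-> xy].
by congr (_, _); apply: val_inj.
Qed.

End Tuples.

Section Words.
Context {T : finType} {s : nat}.
Implicit Types (a : 'I_s -> seq T) (w x : seq T).

Definition avoids a w := [forall i, ~~ infix (a i) w].

Definition antichain a := forall i j, infix (a i) (a j) -> i = j.

Lemma avoidsP a w : reflect (forall i, ~~ infix (a i) w) (avoids a w).
Proof. exact: forallP. Qed.

Lemma avoids_infix a w x : infix w x -> avoids a x -> avoids a w.
Proof.
move=> wx /avoidsP ax; apply/avoidsP => i; apply: contra (ax i) => iw.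
exact: infix_trans iw wx.
Qed.

(** A forbidden word created by appending a letter uses that letter. *)
Lemma infix_rcons_suffix a w e i : avoids a w ->
  infix (a i) (rcons w e) -> suffix (a i) (rcons w e).
Proof.
move=> aw /infixP[u [v]]; elim/last_ind: v => [|v e' _].
  by rewrite cats0 => ->; exact: suffix_suffix.
rewrite -!rcons_cat => /rcons_inj[wE _].
by have := avoidsP _ _ aw i; rewrite wE infix_infix.
Qed.

Lemma avoids_rev a w : avoids (fun i => rev (a i)) (rev w) = avoids a w.
Proof. by apply: eq_forallb => i; rewrite infix_rev. Qed.

Lemma antichain_rev a : antichain a -> antichain (fun i => rev (a i)).
Proof. by move=> ha i j; rewrite infix_rev; apply: ha. Qed.

End Words.

Section Weights.
Context {R : fieldType} {T : finType} {s : nat} (a : 'I_s -> seq T).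
Variables (z d : R) (c : 'I_s -> R).
Implicit Types (w x : seq T) (e : T).

(** The coordinate of the eigenvector, extended to all words and with the
constant [1] replaced by [d]; [d = 0] serves to study the kernel of the
correlation matrix. *)
Definition weight x : R := d - \sum_j c j * overlap_sum z x (a j).

(** For [d = 1] and column sums [c] of the inverse correlation matrix this is
z - q + r(z), whose zero at the Perron root is the heart of the matter. *)
Definition defect : R := (z - #|T|%:R) * d + \sum_j c j.

Definition weight_system :=
  forall k, \sum_j c j * overlap_sum z (a k) (a j) = d.

Hypothesis a_neq0 : forall i, a i != [::].
Hypothesis a_anti : antichain a.
Hypothesis c_sys : weight_system.

Lemma weight_nil : weight [::] = d.
Proof.
by rewrite /weight big1 ?subr0 // => j _; rewrite overlap_sum0x mulr0.
Qed.

(** Each overlap sum obeys [sum_overlap_sum_rcons], and the constants [1] that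
it produces add up to [\sum_j c j]. *)
Lemma sum_weight_rcons x : avoids a x ->
  \sum_e weight (rcons x e) = z * weight x - defect.
Proof.
move=> /avoidsP ax; rewrite /weight sumrB exchange_big /=.
under [X in _ - X]eq_bigr => j _.
  rewrite -mulr_sumr sum_overlap_sum_rcons //; last first.
    by apply: contra (ax j); exact: suffixW.
  rewrite mulrDr mulr1 mulrCA; over.
rewrite sumr_const -mulr_natl cardT -cardE big_split /= -mulr_sumr /defect.
ring.
Qed.

(** Forbidden words do not contain one another, so the overlaps of [x] with any
[a j] all lie inside the suffix [a k] of [x]; the weight of [x] is therefore
that of [a k], which [c_sys] makes zero. *)
Lemma weight_suffix x k : suffix (a k) x -> weight x = 0.
Proof.
move=> kx; rewrite /weight -(c_sys k) -sumrB big1 // => j _.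
rewrite -mulrBr (_ : _ - _ = 0) ?mulr0 //; apply/eqP; rewrite subr_eq0.
apply/eqP; apply: eq_bigr => m _; congr ((nat_of_bool _)%:R * _).
apply/idP/idP => [mk|mx]; first exact: suffix_trans mk kx.
have [le_mk|lt_km] := leqP (size (take m.+1 (a j))) (size (a k)).
  exact: suffix_suffix_le mx kx le_mk.
have km := suffix_suffix_le kx mx (ltnW lt_km).
have kj : k = j.
  by apply: a_anti; exact: infix_trans (suffixW km) (infix_take _ _).
by move: lt_km; rewrite kj size_take_min ltnNge geq_minr.
Qed.

(** An overlap using the first letter of [e :: x] would be all of [e :: x],
hence, by the size bound, a forbidden word. *)
Lemma weight_cons x e : avoids a (e :: x) ->
  (forall j, size (a j) <= (size x).+1)%N -> weight (e :: x) = weight x.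
Proof.
move=> /avoidsP ax le_ax; rewrite /weight; congr (_ - _).
apply: eq_bigr => j _; rewrite overlap_sum_consl.
case: (boolP (prefix _ _)) => [|_]; last by rewrite mul0r addr0.
rewrite prefixE take_oversize ?le_ax // => /eqP axj.
by have := ax j; rewrite axj infix_refl.
Qed.

(** The words [a k] and [behead (a k)] have the same overlaps with the family
except the total overlap of [a k] with itself. Read backwards, this recovers
the coefficients [c] from the weights. *)
Lemma weight_behead k : weight (behead (a k)) = c k * z ^+ (size (a k)).-1.
Proof.
rewrite /weight -(c_sys k); case ak: (a k) => [|e x] /=.
  by have := a_neq0 k; rewrite ak.
rewrite -sumrB (bigD1 k) //= -mulrBr overlap_sum_consl ak prefix_refl mul1r.
rewrite addrAC subrr add0r big1 ?addr0 // => j jk.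
rewrite overlap_sum_consl (_ : prefix _ _ = false) ?mul0r ?addr0 ?subrr //.
apply/negP; rewrite -ak => /prefixW /a_anti kj; by rewrite kj eqxx in jk.
Qed.

(** Words that stop avoiding the family carry weight zero, so the sum may be
restricted to those that do not. *)
Lemma sum_avoids_weight_rcons x : avoids a x ->
  \sum_(e | avoids a (rcons x e)) weight (rcons x e) = z * weight x - defect.
Proof.
move=> ax; rewrite -sum_weight_rcons // big_mkcond; apply: eq_bigr => e _.
case: (boolP (avoids _ _)) => // /forallPn[k]; rewrite negbK => kxe.
by rewrite (@weight_suffix _ k) //; exact: infix_rcons_suffix ax kxe.
Qed.

Lemma sum_avoids_weightS n :
  \sum_(w : n.+1.-tuple T | avoids a w) weight w =
  z * \sum_(w : n.-tuple T | avoids a w) weight w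
  - #|[pred w : n.-tuple T | avoids a w]|%:R * defect.
Proof.
rewrite big_mkcond.
rewrite (sum_tuple_rcons n (fun w => if avoids a w then weight w else 0)).
rewrite mulr_sumr mulr_natl -sumr_const -sumrB [RHS]big_mkcond /=.
apply: eq_bigr => x _; rewrite -big_mkcond.
case: (boolP (avoids a x)) => [ax|nax]; first exact: sum_avoids_weight_rcons.
rewrite big_pred0 // => e; apply/negbTE; apply: contra nax.
by apply: avoids_infix; exact: infix_rcons.
Qed.

Hypothesis no_defect : defect = 0.

Lemma sum_avoids_weight n :
  \sum_(w : n.-tuple T | avoids a w) weight w = z ^+ n * d.
Proof.
elim: n => [|n IHn]; last first.
  by rewrite sum_avoids_weightS no_defect IHn mulr0 subr0 exprS mulrA.
rewrite (big_pred1 [tuple]) ?weight_nil ?mul1r // => w.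
rewrite (tuple0 w) /= eqxx; apply/forallP => i.
by rewrite infixs0.
Qed.

(** By [sum_avoids_weight_rcons] without defect, vanishing passes from the
one-letter extensions of a word to the word; from length [n] it descends to
the words [behead (a k)], whose weights are multiples of [c k]. *)
Lemma weight_eq0 n : z != 0 -> (forall j, (size (a j)).-1 <= n)%N ->
  (forall w, size w = n -> avoids a w -> weight w = 0) -> forall k, c k = 0.
Proof.
move=> z0 le_an wn0.
have w0 m w : size w = (n - m)%N -> avoids a w -> weight w = 0.
  elim: m w => [|m IHm] w wm aw; first by apply: wn0; rewrite // wm subn0.
  have [lt_mn|le_nm] := ltnP m n; last first.
    by apply: IHm => //; move: wm le_nm; rewrite -!subn_eq0 subnS => -> /eqP ->.
  have := sum_avoids_weight_rcons aw; rewrite big1 => [|e ae]; last first.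
    by apply: IHm => //; rewrite size_rcons wm subnSK.
  by rewrite no_defect subr0 => /esym/eqP; rewrite mulf_eq0 (negbTE z0) => /eqP.
move=> k; have := weight_behead k; rewrite (w0 (n - (size (a k)).-1)%N).
- by move/esym/eqP; rewrite mulf_eq0 expf_eq0 (negbTE z0) andbF orbF => /eqP.
- by rewrite size_behead subKn.
apply/avoidsP => i; apply/negP => ik.
have /a_anti ik' : infix (a i) (a k).
  by apply: infix_trans ik _; rewrite -drop1 infix_drop.
have := size_infix ik; rewrite ik' size_behead.
by case: (a k) (a_neq0 k) => //= ? ? _; rewrite ltnn.
Qed.

End Weights.

(** * Correlations and allowed words *)

Section Correlation.
Variable q : nat.
Implicit Types x y t : seq 'I_q.

Lemma prefix_onthP x y : (size x <= size y)%N ->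
  reflect (forall k, (k < size x)%N -> onth x k = onth y k) (prefix x y).
Proof.
move=> le_xy; apply: (iffP idP) => [/prefixP[t ->] k kx|xy].
  by rewrite onth_cat kx.
rewrite prefixE; apply/eqP/eq_from_onth_le => k.
rewrite size_takel // maxnn => kx; rewrite xy //.
by rewrite !onthE map_take nth_take.
Qed.

Lemma overlapP x y l :
  reflect (forall k, (k < minn (size x - l) (size y))%N ->
             onth (drop l x) k = onth y k) (overlap x y l).
Proof.
have dropE k : onth (drop l x) k = onth x (l + k).
  by rewrite !onthE map_drop nth_drop.
apply: (iffP forallP) => [h k kl|h k]; last by rewrite -dropE h.
by rewrite dropE; apply/eqP; exact: (h (Ordinal kl)).
Qed.

(** In general [overlap x y l] also holds when [y] is a prefix of [drop l x];
the hypothesis leaves no such case where [y] ends before [x] does. *)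
Lemma overlap_prefix x y l :
  (prefix y (drop l x) -> (size x - l <= size y)%N) ->
  overlap x y l = prefix (drop l x) y.
Proof.
move=> le_xy; have [le|lt] := leqP (size x - l) (size y).
  have le' : (size (drop l x) <= size y)%N by rewrite size_drop.
  apply/overlapP/(prefix_onthP le'); rewrite size_drop (minn_idPl le) //.
have le' : (size y <= size (drop l x))%N by rewrite size_drop ltnW.
apply/overlapP/idP => [h|/size_prefix]; last by rewrite size_drop leqNgt lt.
have /le_xy : prefix y (drop l x).
  by apply/(prefix_onthP le') => k ky; rewrite h // (minn_idPr (ltnW lt)).
by rewrite leqNgt lt.
Qed.

Lemma horner_corr (R : realType) x y (z : R) :
  (forall l, prefix y (drop l x) -> (size x - l <= size y)%N) ->
  (corr R x y).[z] = overlap_sum z x y.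
Proof.
move=> le_xy; rewrite overlap_sum_size /corr horner_sum [RHS]big_mkcond /=.
rewrite (reindex_inj rev_ord_inj) /=; apply: eq_bigr => m _.
rewrite hornerZ hornerXn overlap_prefix; last exact: le_xy.
rewrite -subnDA add1n subnSK // subKn ?(ltnW (ltn_ord m)) //.
by case: prefix; rewrite ?mul1r ?mul0r.
Qed.

End Correlation.

Section Allowed.
Variables (q s : nat) (a : 'I_s -> seq 'I_q).
Implicit Types (v w : seq 'I_q) (x : nat -> 'I_q).

Lemma occurs_infix v w x : infix v w -> occurs w x -> occurs v x.
Proof.
move=> /infixP[t [r ->]] [n wE]; exists (n + size t)%N.
apply: (@eq_from_nth _ (x 0)) => [|k kv]; first by rewrite size_mkseq.
rewrite nth_mkseq // -addnA.
have : nth (x 0) (t ++ v ++ r) (size t + k) =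
       nth (x 0) (mkseq (fun k => x (n + k)%N) (size (t ++ v ++ r)))
         (size t + k).
  by rewrite -wE.
rewrite nth_mkseq; last by rewrite !size_cat ltn_add2l ltn_addr.
by rewrite nth_cat ltnNge leq_addr /= addKn nth_cat kv.
Qed.

Lemma allowed_avoids w : allowed a w -> avoids a w.
Proof.
move=> [x xa wx]; apply/avoidsP => i; apply/negP => iw.
exact: xa i (occurs_infix iw wx).
Qed.

Hypothesis q_gt0 : (0 < q)%N.
Hypothesis a_inj : injective a.
Hypothesis a_neq0 : forall i, a i != [::].
Hypothesis a_min : minimal_collection a.

(** A proper subword of a forbidden word is allowed, while a forbidden word is
not. *)
Lemma minimal_antichain : antichain a.
Proof.
move=> i j ij; apply: a_inj; apply/eqP; apply: contraT => nij.
have /allowed_avoids/avoidsP/(_ i) := a_min ij nij.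
by rewrite infix_refl.
Qed.

(** Suppose each letter [e] completes a forbidden word [a (f e)] at the end of
[rcons w e], and let [a (f e) = rcons v e] be a longest of these words. By
minimality [v] is allowed, so it is followed by some letter [e'] in a sequence
of the shift. But [a (f e')] is no longer than [rcons v e'], so it is a suffix
of it, and the forbidden word [a (f e')] occurs in a sequence of the shift,
which is absurd. *)
Lemma avoids_extend w : avoids a w -> exists e, avoids a (rcons w e).
Proof.
move=> aw; apply/existsP; apply: contraT => /existsPn nex.
have /fin_all_exists[f fP] e : exists i, suffix (a i) (rcons w e).
  have /forallPn[k] := nex e; rewrite negbK => kw.
  by exists k; exact: infix_rcons_suffix aw kw.
case: (@arg_maxnP _ (Ordinal q_gt0) predT
  (fun e => size (a (f e))) isT) => e _ e_max.
case/lastP afe: (a (f e)) => [|v e1].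
  by have := a_neq0 (f e); rewrite afe.
have := fP e; rewrite afe suffix_rcons => /andP[_ vw].
have v_inf : infix v (a (f e)) by rewrite afe infix_rcons.
have v_neq : v != a (f e).
  by apply/eqP => /(congr1 size)/eqP; rewrite afe size_rcons ltn_eqF.
have [x xa [n vx]] := a_min v_inf v_neq.
pose e' := x (n + size v)%N; case: (xa (f e')).
apply: (@occurs_infix _ (rcons v e')).
  apply: suffixW; apply: suffix_suffix_le (fP e') _ _.
    by rewrite suffix_rcons eqxx.
  by have := e_max e' isT; rewrite afe !size_rcons.
exists n; rewrite size_rcons /mkseq -addn1 iotaD map_cat -cats1.
by congr (_ ++ _).
Qed.

(** Extending [w] letter by letter yields a sequence of the shift: a forbidden
word occurring in it would occur in one of the finite stages. *)
Lemma avoids_allowed w : avoids a w -> allowed a w.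
Proof.
move=> aw.
have /choice[f fP] v : exists e, avoids a v -> avoids a (rcons v e).
  case: (boolP (avoids a v)) => [/avoids_extend[e]|_]; first by exists e.
  by exists (Ordinal q_gt0).
pose W n := iter n (fun v => rcons v (f v)) w.
have sW n : size (W n) = (size w + n)%N.
  by elim: n => [|n IH]; rewrite ?addn0 //= size_rcons IH addnS.
have aW n : avoids a (W n) by elim: n => //= n; exact: fP.
pose e0 := Ordinal q_gt0; pose x k := nth e0 (W k.+1) k.
have Wx n m k : (k < size (W n))%N -> nth e0 (W (m + n)%N) k = nth e0 (W n) k.
  move=> kn; elim: m => // m <-; rewrite addSn /= nth_rcons.
  by rewrite sW (leq_trans kn) // sW leq_add2l leq_addl.
have xE n k : (k < size (W n))%N -> x k = nth e0 (W n) k.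
  move=> kn; rewrite /x -(Wx k.+1 n) ?[(n + _)%N]addnC ?Wx //.
  by rewrite sW addnS ltnS leq_addl.
exists x; last first.
  exists 0%N; apply: (@eq_from_nth _ e0) => [|k kw].
    by rewrite size_mkseq.
  by rewrite nth_mkseq // (xE 0%N).
move=> i [n iE]; have /avoidsP/(_ i)/negP := aW (n + size (a i))%N; apply.
suff iW : take (size (a i)) (drop n (W (n + size (a i))%N)) = a i.
  by rewrite -{1}iW; exact: infix_trans (infix_take _ _) (infix_drop _ _).
have sd : (size (a i) <= size (drop n (W (n + size (a i)))))%N.
  by rewrite size_drop sW addnCA addKn leq_addl.
apply/esym/(@eq_from_nth _ e0) => [|k ki]; first by rewrite size_takel.
rewrite nth_take // nth_drop -xE; last first.
  by rewrite sW addnCA ltn_add2l ltn_addl.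
by rewrite [in LHS]iE nth_mkseq.
Qed.

Lemma allowedE w : `[< allowed a w >] = avoids a w.
Proof.
by apply/asboolP/idP => [|/avoids_allowed //]; exact: allowed_avoids.
Qed.

End Allowed.

(** * The adjacency matrix acting on weights *)

Section Adjacency.
Context {R : realType} {q s : nat} (a : 'I_s -> seq 'I_q).
Hypothesis q_gt0 : (0 < q)%N.
Hypothesis s_gt0 : (0 < s)%N.
Hypothesis a_inj : injective a.
Hypothesis a_size : forall i, (2 <= size (a i))%N.
Hypothesis a_min : minimal_collection a.
Implicit Types (w x : seq 'I_q) (e : 'I_q).

Local Notation N := (max_length a).-1.
Local Notation A := (adjacency R a).

Lemma forbidden_neq0 i : a i != [::].
Proof. by have := a_size i; case: (a i). Qed.

Lemma allowed_avoidsE w : `[< allowed a w >] = avoids a w.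
Proof. exact: allowedE forbidden_neq0 a_min w. Qed.

Lemma size_le_max_length i : (size (a i) <= max_length a)%N.
Proof. exact: (leq_bigmax_cond (F := fun i => size (a i))). Qed.

Lemma max_length_gt1 : (1 < max_length a)%N.
Proof. exact: leq_trans (a_size (Ordinal s_gt0)) (size_le_max_length _). Qed.

Lemma state_avoids (i : 'I_(nstates a)) : avoids a (state i).
Proof. by rewrite -allowed_avoidsE; have := enum_valP i; rewrite inE. Qed.

Lemma size_forbidden_state j (i : 'I_(nstates a)) :
  (size (a j) <= (size (state i)).+1)%N.
Proof.
by rewrite size_tuple prednK ?size_le_max_length // ltnW // max_length_gt1.
Qed.

Lemma sum_state (F : seq 'I_q -> R) :
  \sum_(j < nstates a) F (state j) = \sum_(y : N.-tuple 'I_q | avoids a y) F y.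
Proof.
rewrite (eq_bigl (fun y => y \in allowed_words a N)) => [|y]; last first.
  by rewrite inE allowed_avoidsE.
by rewrite [RHS]big_enum_val.
Qed.

Lemma adjacencyE (i j : 'I_(nstates a)) : A i j =
  ((behead (state i) == take (max_length a).-2 (state j)) &&
   avoids a (state i ++ drop (max_length a).-2 (state j)))%:R.
Proof. by rewrite mxE allowed_avoidsE. Qed.

(** The successors of a state are obtained by appending a letter and dropping
the first one. *)
Lemma sum_adjacency_row (f : seq 'I_q -> R) (i : 'I_(nstates a)) :
  \sum_j A i j * f (state j) =
  \sum_(e | avoids a (rcons (state i) e)) f (behead (rcons (state i) e)).
Proof.
under eq_bigr => j _ do rewrite adjacencyE.
pose F y := ((behead (state i) == take (max_length a).-2 y) &&
   avoids a (state i ++ drop (max_length a).-2 y))%:R * f y.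
rewrite (sum_state F) {}/F; move: (state i) => x.
have := max_length_gt1; case: (max_length a) x => [|[|n]] // x _ /=.
rewrite big_mkcond (sum_tuple_rcons n (fun y => if avoids a y then
  ((behead x == take n y) && avoids a (x ++ drop n y))%:R * f y else 0)).
rewrite (bigD1 [tuple of behead x]) //= [X in _ + X]big1 ?addr0 => [|y yx].
  rewrite [RHS]big_mkcond; apply: eq_bigr => e _.
  have sx : size (behead x) = n by rewrite size_tuple.
  rewrite -cats1 take_cat drop_cat sx ltnn subnn take0 drop0 cats0 eqxx /=.
  rewrite !cats1.
  case: (tupleP x) => e' x' /=.
  case: (boolP (avoids a (e' :: rcons x' e))) => axe; last first.
    by rewrite mul0r if_same.
  by rewrite mul1r (avoids_infix _ axe) // infix_cons.
apply: big1 => e _; case: ifP => // _.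
rewrite -cats1 take_cat size_tuple ltnn subnn take0 cats0.
case: eqP => [xy|]; last by rewrite mul0r.
by move/eqP: yx; case; apply: val_inj.
Qed.

(** The predecessors of a state are obtained by prepending a letter and
dropping the last one. *)
Lemma sum_adjacency_col (f : seq 'I_q -> R) (j : 'I_(nstates a)) :
  \sum_i f (state i) * A i j =
  \sum_(e | avoids a (e :: state j)) f (e :: take (max_length a).-2 (state j)).
Proof.
under eq_bigr => i _ do rewrite adjacencyE.
pose F x := f x * ((behead x == take (max_length a).-2 (state j)) &&
   avoids a (x ++ drop (max_length a).-2 (state j)))%:R.
rewrite (sum_state F) {}/F; move: (state j) => y.
have := max_length_gt1; case: (max_length a) y => [|[|n]] // y _ /=.
rewrite big_mkcond (sum_tuple_cons n (fun x => if avoids a x then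
  f x * ((behead x == take n y) && avoids a (x ++ drop n y))%:R else 0)).
have st : size (take n y) == n by rewrite size_takel // size_tuple.
rewrite (bigD1 (Tuple st)) //= [X in _ + X]big1 ?addr0 => [|x xy].
  rewrite [RHS]big_mkcond; apply: eq_bigr => e _.
  rewrite eqxx cat_take_drop /=.
  case: (boolP (avoids a (e :: y))) => aey; last by rewrite mulr0 if_same.
  rewrite mulr1 (avoids_infix _ aey) //.
  by rewrite -[y in infix _ (e :: y)](cat_take_drop n) -cat_cons prefix_infix.
apply: big1 => e _; case: ifP => // _.
case: eqP => [xyE|]; last by rewrite mulr0.
by move/eqP: xy; case; apply: val_inj.
Qed.

(** For a state [x] and a letter [e] such that [rcons x e] avoids the family,
the words [rcons x e] and [behead (rcons x e)] have the same weight by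
[weight_cons], so the sum over the successors of [x] is the sum in
[sum_avoids_weight_rcons]. *)
Lemma adjacency_weight z d (c : 'I_s -> R) : weight_system a z d c ->
  let V := \col_(i < nstates a) weight a z d c (state i) in
  A *m V = z *: V - const_mx (defect (T := 'I_q) z d c).
Proof.
move=> sys V; apply/matrixP => i k; rewrite !mxE.
under eq_bigr => j _ do rewrite [V _ _]mxE.
rewrite (sum_adjacency_row (weight a z d c)).
rewrite -(sum_avoids_weight_rcons forbidden_neq0
  (minimal_antichain a_inj a_min)) //; last exact: state_avoids.
apply: eq_bigr => e.
have := size_forbidden_state ^~ i; case: (state i) => [[|e' x] sx] //= ax axe.
  by have := max_length_gt1; rewrite -subn_gt0 subn1 -(eqP sx).
rewrite weight_cons // => j; first by rewrite size_rcons; exact: ax.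
Qed.

Let ra i := rev (a i).

(** The same computation for the reversed family, where appending a letter to a
reversed word is prepending it to the word. *)
Lemma adjacency_weight_rev z d (c : 'I_s -> R) : weight_system ra z d c ->
  let U := \col_(i < nstates a) weight ra z d c (rev (state i)) in
  U^T *m A = z *: U^T - const_mx (defect (T := 'I_q) z d c).
Proof.
move=> sys U; apply/matrixP => k j; rewrite !mxE.
under eq_bigr => i _ do rewrite [U^T _ _]mxE [U _ _]mxE.
rewrite (sum_adjacency_col (fun x => weight ra z d c (rev x))).
have ra0 i : ra i != [::].
  by rewrite -size_eq0 size_rev size_eq0 forbidden_neq0.
rewrite -(sum_avoids_weight_rcons ra0
  (antichain_rev (minimal_antichain a_inj a_min)) sys); last first.
  by rewrite avoids_rev state_avoids.
apply: eq_big => [e|e]; first by rewrite -rev_cons avoids_rev.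
have := size_forbidden_state ^~ j.
have := size_tuple (state j); have := max_length_gt1.
case: (max_length a) (state j) => [|[|n]] // y _ /= sy ay aey.
move: sy ay aey; case/lastP: (tval y) => // x e' sx ay aey.
have -> : take n (rcons x e') = x.
  by move: sx; rewrite size_rcons -cats1 => -[<-]; rewrite take_size_cat.
rewrite -rev_cons -rcons_cons rev_rcons weight_cons //.
  by rewrite -rev_rcons avoids_rev.
by move=> i; rewrite !size_rev; move: (ay i); rewrite size_rcons.
Qed.

Lemma sum_state_weight z d (c : 'I_s -> R) :
  weight_system a z d c -> defect (T := 'I_q) z d c = 0 ->
  \sum_(i < nstates a) weight a z d c (state i) = z ^+ N * d.
Proof.
move=> sys d0; rewrite (sum_state (weight a z d c)).
exact: (sum_avoids_weight forbidden_neq0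
  (minimal_antichain a_inj a_min) sys d0).
Qed.

Lemma sum_state_weight_rev z d (c : 'I_s -> R) :
  weight_system ra z d c -> defect (T := 'I_q) z d c = 0 ->
  \sum_(i < nstates a) weight ra z d c (rev (state i)) = z ^+ N * d.
Proof.
move=> sys d0; rewrite (sum_state (fun x => weight ra z d c (rev x))).
have ra0 i : ra i != [::].
  by rewrite -size_eq0 size_rev size_eq0 forbidden_neq0.
rewrite -(sum_avoids_weight ra0
  (antichain_rev (minimal_antichain a_inj a_min)) sys d0).
have revK_tuple : cancel (fun w : N.-tuple 'I_q => [tuple of rev w])
    (fun w : N.-tuple 'I_q => [tuple of rev w]).
  by move=> w; apply: val_inj; exact: revK.
rewrite [RHS](reindex_inj (can_inj revK_tuple)) /=.
by apply: eq_bigl => w; rewrite avoids_rev.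
Qed.

Lemma state_surj (x : N.-tuple 'I_q) : allowed a x ->
  exists i : 'I_(nstates a), state i = x.
Proof.
move=> ax; have xin : x \in allowed_words a N by rewrite inE; apply/asboolP.
by exists (enum_rank_in xin x); rewrite /state enum_rankK_in.
Qed.

(** Minimality makes the empty word allowed, so the shift is not empty. *)
Lemma nstates_gt0 : (0 < nstates a)%N.
Proof.
have [x xa _] : allowed a [::].
  apply: (a_min (i := Ordinal s_gt0)); first exact: infix0s.
  by rewrite eq_sym forbidden_neq0.
apply/card_gt0P; exists [tuple x i | i < N].
rewrite inE; apply/asboolP; exists x => //; exists 0%N.
rewrite size_tuple /= /mkseq -val_enum_ord -map_comp; apply: eq_map => k /=.
by rewrite add0n.
Qed.

End Adjacency.

(** * Perron-Frobenius theory of irreducible matrices *)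

Section Irreducible.
Context {R : realType} {n : nat}.
Implicit Types (A : 'M[R]_n) (x : 'rV[R]_n) (v : 'cV[R]_n) (t : R).

Lemma trmx_exp A l : (A ^+ l)^T = A^T ^+ l.
Proof.
elim: l => [|l IHl]; first by rewrite !expr0 trmx1.
by rewrite exprS exprSr -IHl; exact: trmx_mul.
Qed.

Lemma irreducible_tr A : irreducible_mx A -> irreducible_mx A^T.
Proof.
move=> irrA i j; have [l l1 Al] := irrA j i; exists l => //.
by rewrite -trmx_exp mxE.
Qed.

Lemma expmx_ge0 A l : (forall i j, 0 <= A i j) -> forall i j, 0 <= (A ^+ l) i j.
Proof.
move=> A0; elim: l => [|l IHl] i j; first by rewrite expr0 mxE ler0n.
by rewrite exprS mxE; apply: sumr_ge0 => k _; exact: mulr_ge0.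
Qed.

(** If [x] vanished at [i], then [x *m A ^+ l <= t ^+ l *: x] would force every
[x 0 k * (A ^+ l) k i] to be zero, against irreducibility. *)
Lemma subinvariant_pos A x t : (forall i j, 0 <= A i j) -> irreducible_mx A ->
  0 <= t -> (forall i, 0 <= x 0 i) -> x != 0 ->
  (forall i, (x *m A) 0 i <= t * x 0 i) -> forall i, 0 < x 0 i.
Proof.
move=> A0 irrA t0 x0 xn0 xA i; rewrite lt0r x0 andbT; apply/negP => /eqP xi0.
have [k xk] : exists k, x 0 k != 0.
  apply/existsP; apply: contraT => /existsPn x_eq0; case/eqP: xn0.
  apply/rowP => k; rewrite [RHS]mxE; apply/eqP.
  by have := x_eq0 k; rewrite negbK.
have [l _ Al] := irrA k i.
have xAl m j : (x *m A ^+ m) 0 j <= t ^+ m * x 0 j.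
  elim: m j => [|m IHm] j; first by rewrite !expr0 mulmx1 mul1r.
  rewrite exprSr (_ : x *m (A ^+ m * A) = x *m A ^+ m *m A); last exact: mulmxA.
  rewrite mxE exprSr -mulrA.
  apply: (@le_trans _ _ (\sum_j0 (t ^+ m * x 0 j0) * A j0 j)).
    by apply: ler_sum => j0 _; rewrite ler_wpM2r.
  under eq_bigr => j0 _ do rewrite -mulrA.
  by rewrite -mulr_sumr ler_wpM2l ?exprn_ge0 //; have := xA j; rewrite mxE.
have := xAl l i; rewrite xi0 mulr0 leNgt => /negP; apply.
rewrite mxE (bigD1 k) //= ltr_pwDl //.
  by rewrite mulr_gt0 // lt0r xk x0.
by apply: sumr_ge0 => j _; rewrite mulr_ge0 // expmx_ge0.
Qed.

(** Taking absolute values gives [A *m |v| >= t *: |v|], and pairing with the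
positive left eigenvector [x] shows that equality holds. So [|v| + v] and
[|v| - v] are nonnegative eigenvectors, each of which is zero or positive. *)
Lemma perron_eigenvector_sign A x v t :
  (forall i j, 0 <= A i j) -> irreducible_mx A ->
  (forall i, 0 < x 0 i) -> x *m A = t *: x -> 0 <= t -> A *m v = t *: v ->
  v = 0 \/ (forall i, 0 < v i 0) \/ (forall i, v i 0 < 0).
Proof.
move=> A0 irrA x0 xA t0 Av.
pose av : 'cV[R]_n := \col_i `|v i 0|.
have Aav : A *m av = t *: av.
  have le_av i : 0 <= (A *m av - t *: av) i 0.
    have tv : t * v i 0 = \sum_k A i k * v k 0.
      by move/matrixP/(_ i 0): Av; rewrite !mxE.
    rewrite !mxE subr_ge0 -{1}(ger0_norm t0) -normrM tv.
    apply: le_trans (ler_norm_sum _ _ _) _.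
    by apply: ler_sum => k _; rewrite normrM ger0_norm // mxE.
  apply/eqP; rewrite -subr_eq0; apply/eqP.
  have : (x *m (A *m av - t *: av)) 0 0 = 0.
    by rewrite mulmxBr mulmxA xA -scalemxAr -scalemxAl subrr mxE.
  rewrite mxE => /eqP; rewrite psumr_eq0 => [|i _]; last first.
    by rewrite mulr_ge0 // ltW.
  move=> /allP x_eq0; apply/colP => i.
  have := x_eq0 i (mem_index_enum _); rewrite /= mulf_eq0 gt_eqF //= => /eqP ->.
  by rewrite mxE.
have pos (w : 'cV[R]_n) : (forall i, 0 <= w i 0) -> A *m w = t *: w ->
    w = 0 \/ forall i, 0 < w i 0.
  move=> w0 Aw; have [->|wn0] := eqVneq w 0; [by left|right => i].
  have := @subinvariant_pos A^T w^T t; rewrite -trmx_mul Aw.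
  move=> /(_ _ _ t0 _ _ _ i); rewrite mxE; apply.
  - by move=> j k; rewrite mxE.
  - exact: irreducible_tr.
  - by move=> j; rewrite mxE.
  - by apply: contra wn0 => /eqP/(congr1 trmx); rewrite trmxK trmx0 => ->.
  - by move=> j; rewrite !mxE.
have avp i : 0 <= (av + v) i 0.
  by rewrite !mxE -lerBlDr sub0r ler_normr lexx orbT.
have avm i : 0 <= (av - v) i 0 by rewrite !mxE subr_ge0 ler_norm.
have [|avp0|avp_gt0] := pos _ avp; first by rewrite mulmxDr Aav Av scalerDr.
  have [|avm0|avm_gt0] := pos _ avm; first by rewrite mulmxBr Aav Av scalerBr.
    left; apply/colP => i; rewrite mxE; apply/eqP; rewrite -normr_eq0.
    have /colP/(_ i) := avp0; have /colP/(_ i) := avm0; rewrite !mxE => h1 h2.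
    by apply/eqP; lra.
  right; right => i; have := avm_gt0 i; have /colP/(_ i) := avp0.
  by rewrite !mxE => h1 h2; lra.
have [|avm0|avm_gt0] := pos _ avm; first by rewrite mulmxBr Aav Av scalerBr.
  right; left => i; have := avp_gt0 i; have /colP/(_ i) := avm0.
  by rewrite !mxE => h1 h2; lra.
left; apply/colP => i; have := avp_gt0 i; have := avm_gt0 i; rewrite !mxE.
by case: (ger0P (v i 0)) => _ h1 h2; lra.
Qed.

Lemma exists_scaling_le (f g : 'I_n -> R) : (forall i, 0 < f i) ->
  (forall i, 0 < g i) -> exists2 e, 0 < e & forall i, e * f i <= g i.
Proof.
move=> f0 g0; case: (pickP (fun _ : 'I_n => true)) => [i0 _|n0]; last first.
  by exists 1 => // i; have := n0 i.
case: (@arg_minP _ _ _ i0 predT (fun i => g i / f i) isT) => i _ imin.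
exists (g i / f i); first by rewrite divr_gt0.
by move=> j; rewrite -ler_pdivlMr // imin.
Qed.

(** Collatz and Wielandt: if [t] is the least value for which [x *m A <= t *: x]
has a nonnegative nonzero solution, then that solution is an eigenvector.
Otherwise the slack [d = t *: x - x *m A] is positive at some [i0], hence
[d *m Q] is positive everywhere for a suitable sum [Q] of powers of [A], and
[x *m Q] admits a value smaller than [t]. *)
Lemma minimal_subinvariant A x t :
  (forall i j, 0 <= A i j) -> irreducible_mx A ->
  0 <= t -> (forall i, 0 <= x 0 i) -> x != 0 ->
  (forall i, (x *m A) 0 i <= t * x 0 i) ->
  (forall (t' : R) (y : 'rV[R]_n), 0 <= t' -> (forall i, 0 <= y 0 i) ->
     y != 0 -> (forall i, (y *m A) 0 i <= t' * y 0 i) -> t <= t') ->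
  x *m A = t *: x.
Proof.
move=> A0 irrA t0 x0 xn0 xA tmin.
have xp := subinvariant_pos A0 irrA t0 x0 xn0 xA.
apply/rowP => i0; apply/eqP; rewrite [X in _ == X]mxE eq_le xA leNgt /=.
apply/negP => lt_i0.
have /choice[l lP] j : exists l, 0 < (A ^+ l) i0 j.
  by have [l _] := irrA i0 j; exists l.
pose L := (\max_j l j).+1; pose Q := \sum_(k < L) A ^+ k.
have Q0 i j : 0 <= Q i j.
  by rewrite summxE; apply: sumr_ge0 => k _; exact: expmx_ge0.
have Qp j : 0 < Q i0 j.
  have lt_lL : (l j < L)%N by rewrite ltnS; exact: leq_bigmax.
  rewrite summxE (bigD1 (Ordinal lt_lL)) //= ltr_pwDl //.
  by apply: sumr_ge0 => k _; exact: expmx_ge0.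
have mulQ_pos (y : 'rV[R]_n) j :
    (forall i, 0 <= y 0 i) -> 0 < y 0 i0 -> 0 < (y *m Q) 0 j.
  move=> y0 yi0; rewrite mxE (bigD1 i0) //= ltr_pwDl ?mulr_gt0 //.
  by apply: sumr_ge0 => k _; rewrite mulr_ge0.
pose d := t *: x - x *m A.
have xQp j : 0 < (x *m Q) 0 j by exact: mulQ_pos.
have dQp j : 0 < (d *m Q) 0 j.
  apply: mulQ_pos => [i|].
    by rewrite !mxE subr_ge0; have := xA i; rewrite mxE.
  by move: lt_i0; rewrite !mxE subr_gt0.
have QA : Q *m A = A *m Q.
  rewrite mulmx_suml mulmx_sumr; apply: eq_bigr => k _.
  by rewrite (_ : A ^+ k *m A = A ^+ k * A) // -exprSr exprS.
have yA j : (x *m Q *m A) 0 j = t * (x *m Q) 0 j - (d *m Q) 0 j.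
  rewrite -mulmxA QA mulmxA mulmxBl -scalemxAl [X in _ - X]mxE.
  by rewrite [X in _ - (X + _)]mxE [X in _ - (_ + X)]mxE; ring.
have [e e0 eP] := exists_scaling_le xQp dQp.
have te_ge j : (x *m Q *m A) 0 j <= (t - e) * (x *m Q) 0 j.
  by rewrite yA mulrBl lerB.
suff : t <= t - e by rewrite lerBrDr gerDl leNgt e0.
apply: (tmin (t - e) (x *m Q)) => // [|j|]; last 2 first.
- exact: ltW.
- apply/eqP => /rowP/(_ i0); rewrite [RHS]mxE => xQ0.
  by have := xQp i0; rewrite xQ0 ltxx.
rewrite -(pmulr_lge0 _ (xQp i0)); apply: le_trans (te_ge i0).
by rewrite mxE; apply: sumr_ge0 => k _; rewrite mulr_ge0 // ltW.
Qed.

Lemma closed_ge0 k (g : 'rV[R]_k -> R) :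
  continuous g -> closed [set y | 0 <= g y].
Proof.
move=> cg; apply: (@preimage_closed _ _ g [set r | 0 <= r]).
  by move=> y _; exact: cg.
exact: closed_ge.
Qed.

Lemma continuous_sumf k (I : finType) (g : I -> 'rV[R]_k -> R) :
  (forall i, continuous (g i)) -> continuous (fun y => \sum_i g i y).
Proof.
by move=> cg; apply: continuous_big => //; exact: add_continuous.
Qed.

(** The pairs of a value [t] and a normalized solution [x] form a compact set
once [t] is bounded by the sum [T] of the entries of [A], a value for which the
constant vector is a solution. A pair is encoded as one row vector with [t] in
front, and the least [t] is found by minimizing the first coordinate. *)
Lemma exists_minimal_subinvariant A : (0 < n)%N -> (forall i j, 0 <= A i j) ->
  exists t (x : 'rV[R]_n), [/\ 0 <= t, forall i, 0 <= x 0 i, x != 0,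
    forall i, (x *m A) 0 i <= t * x 0 i &
    forall (t' : R) (y : 'rV[R]_n), 0 <= t' -> (forall i, 0 <= y 0 i) ->
      y != 0 -> (forall i, (y *m A) 0 i <= t' * y 0 i) -> t <= t'].
Proof.
move=> n_gt0 A0; pose T := \sum_i \sum_j A i j.
have T0 : 0 <= T by apply: sumr_ge0 => i _; apply: sumr_ge0.
pose x_ (y : 'rV[R]_n.+1) (i : 'I_n) : R := y 0 (lift ord0 i).
pose K := [set y : 'rV[R]_n.+1 | 0 <= y 0 0] `&`
  [set y : 'rV[R]_n.+1 | 0 <= T - y 0 0] `&`
  [set y : 'rV[R]_n.+1 | 0 <= \sum_i x_ y i - 1] `&`
  [set y : 'rV[R]_n.+1 | 0 <= 1 - \sum_i x_ y i] `&`
  \bigcap_i [set y : 'rV[R]_n.+1 | 0 <= x_ y i] `&`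
  \bigcap_i [set y : 'rV[R]_n.+1 |
    0 <= y 0 0 * x_ y i - \sum_k x_ y k * A k i].
have c0 : continuous (fun y : 'rV[R]_n.+1 => y 0 0) by exact: coord_continuous.
have cx i : continuous (fun y => x_ y i) by exact: coord_continuous.
have cS : continuous (fun y : 'rV[R]_n.+1 => \sum_i x_ y i).
  by apply: continuous_sumf => i; exact: cx.
have cc (r : R) : continuous (fun y : 'rV[R]_n.+1 => r).
  exact: cst_continuous.
have cB (f g : 'rV[R]_n.+1 -> R) : continuous f -> continuous g ->
    continuous (fun y => f y - g y).
  by move=> cf cg y; exact: (continuousB (cf y) (cg y)).
have cM (f g : 'rV[R]_n.+1 -> R) : continuous f -> continuous g ->
    continuous (fun y => f y * g y).
  by move=> cf cg y; exact: (continuousM (cf y) (cg y)).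
have Kcl : closed K.
  do ?apply: closedI.
  - exact: closed_ge0.
  - exact/closed_ge0/cB.
  - by apply/closed_ge0/cB; [exact: cS|exact: cc].
  - by apply/closed_ge0/cB; [exact: cc|exact: cS].
  - by apply: closed_bigI => i _; exact: closed_ge0.
  apply: closed_bigI => i _; apply/closed_ge0/cB; first exact: cM.
  by apply: continuous_sumf => k; apply: cM; [exact: cx|exact: cc].
have Kc : compact K.
  have boxc : compact
      [set y : 'rV[R]_n.+1 | forall i, `[0, T + 1]%classic (y ord0 i)].
    apply: (@rV_compact _ _ (fun=> `[0, T + 1]%classic)) => i.
    exact: segment_compact.
  apply: subclosed_compact Kcl boxc _ => y [[[[[y0 yT] _] S1] xge0] _] i /=.
  rewrite in_itv /=; move: y0 yT S1 xge0; rewrite /= !subr_ge0 => y0 yT S1 xge0.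
  case: (unliftP ord0 i) => [j ->|->].
    have xj := xge0 j I; rewrite xj /=.
    apply: (@le_trans _ _ 1); last by rewrite lerDr.
    apply: le_trans S1; rewrite (bigD1 j) //= lerDl; apply: sumr_ge0 => k _.
    exact: xge0 k I.
  by rewrite y0 (le_trans yT) // lerDl.
pose mk (t : R) (x : 'rV[R]_n) : 'rV[R]_n.+1 :=
  \row_i (if unlift ord0 i is Some j then x 0 j else t).
have mk0 t x : mk t x 0 0 = t by rewrite mxE unlift_none.
have mkx t x i : x_ (mk t x) i = x 0 i by rewrite /x_ mxE liftK.
have mkK t' (y : 'rV[R]_n) : 0 <= t' -> t' <= T -> (forall i, 0 <= y 0 i) ->
    y != 0 -> (forall i, (y *m A) 0 i <= t' * y 0 i) ->
    K (mk t' ((\sum_i y 0 i)^-1 *: y)).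
  move=> t'0 t'T y0 yn0 yA.
  have S0 : 0 < \sum_i y 0 i.
    rewrite lt0r sumr_ge0 ?andbT //; apply: contra yn0; rewrite psumr_eq0 //.
    move=> /allP yi0; apply/eqP/rowP => i; rewrite mxE.
    by apply/eqP; exact: yi0 i (mem_index_enum _).
  have S1 : \sum_i x_ (mk t' ((\sum_i y 0 i)^-1 *: y)) i = 1.
    under eq_bigr => i _ do rewrite mkx mxE.
    by rewrite -mulr_sumr mulVf // gt_eqF.
  split; [split; [split; [split; [split|]|]|]|] => /=.
  - by rewrite mk0.
  - by rewrite mk0 subr_ge0.
  - by rewrite S1 subrr.
  - by rewrite S1 subrr.
  - by move=> i _ /=; rewrite mkx mxE mulr_ge0 // invr_ge0 ltW.
  - move=> i _ /=; rewrite mk0 mkx mxE subr_ge0 mulrCA.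
    under eq_bigr => k _ do rewrite mkx mxE -mulrA.
    rewrite -mulr_sumr ler_wpM2l ?invr_ge0 ?(ltW S0) //.
    by have := yA i; rewrite mxE.
have one_neq0 : (const_mx 1 : 'rV[R]_n) != 0.
  by apply/eqP => /rowP/(_ (Ordinal n_gt0))/eqP; rewrite !mxE oner_eq0.
have K0 : K !=set0.
  exists (mk T ((\sum_i (const_mx 1 : 'rV[R]_n) 0 i)^-1 *: const_mx 1)).
  apply: mkK => // i; rewrite !mxE // mulr1.
  under eq_bigr => k _ do rewrite mxE mul1r.
  apply: ler_sum => k _; rewrite (bigD1 i) //= lerDl.
  by apply: sumr_ge0.
have [y] := EVT_min_rV K0 Kc (continuous_subspaceT c0).
rewrite inE => -[[[[[y0 yT] S1] S1'] xge0] xA] ymin.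
have yx i : (\row_i x_ y i) 0 i = x_ y i by rewrite mxE.
exists (y 0 0), (\row_i x_ y i); split => //.
- by move=> i; rewrite yx; exact: xge0 i I.
- apply/eqP => /rowP x_eq0; move: S1; rewrite /= big1 => [|i _].
    by rewrite sub0r oppr_ge0 ler10.
  by rewrite -yx x_eq0 mxE.
- move=> i; rewrite yx -subr_ge0 mxE; under eq_bigr => k _ do rewrite yx.
  exact: xA i I.
move=> t' w t'0 w0 wn0 wA; have [t'T|/ltW Tt'] := leP t' T; last first.
  by apply: le_trans Tt'; rewrite -subr_ge0.
by have := ymin _ (mem_set (mkK t' w t'0 t'T w0 wn0 wA)); rewrite mk0.
Qed.

(** For a complex eigenvector [xi] choose the coordinate [i] where the ratio of
the modulus of [xi] to the positive [x] is largest; the eigenvalue equation at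
[i] bounds the modulus of its eigenvalue by [t]. *)
Lemma spectral_radius_pos_eigenvector A x t :
  (0 < n)%N -> (forall i j, 0 <= A i j) ->
  (forall i, 0 < x 0 i) -> x *m A = t *: x -> spectral_radius A = t.
Proof.
move=> n_gt0 A0 x0 xA; pose Cr := real_complex R.
have xAi i : \sum_k x 0 k * A k i = t * x 0 i.
  by move/rowP/(_ i): xA; rewrite !mxE.
have t0 : 0 <= t.
  rewrite -(pmulr_lge0 _ (x0 (Ordinal n_gt0))) -xAi.
  by apply: sumr_ge0 => k _; rewrite mulr_ge0 // ltW.
have norm_real (r : R) : 0 <= r -> ComplexField.Normc.normc (Cr r) = r.
  by move=> r0; rewrite /= expr0n /= addr0 sqrtr_sqr ger0_norm.
have normc_ge0 (z : R[i]) : 0 <= ComplexField.Normc.normc z.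
  by case: z => ? ?; exact: sqrtr_ge0.
have t_eig : eigenvalue (map_mx Cr A) (Cr t).
  apply/eigenvalueP; exists (map_mx Cr x).
    by rewrite -map_mxM xA map_mxZ.
  apply/eqP => /rowP/(_ (Ordinal n_gt0)); rewrite !mxE => /eqP.
  by rewrite fmorph_eq0 gt_eqF.
have t_ub : ubound [set ComplexField.Normc.normc z
    | z in [set z : R[i] | eigenvalue (map_mx Cr A) z]] t.
  move=> _ [mu /eigenvalueP[xi xiA xin0] <-].
  have [k0 xik0] : exists k, xi 0 k != 0.
    apply/existsP; apply: contraT => /existsPn xi0; case/eqP: xin0.
    apply/rowP => k; rewrite [RHS]mxE; apply/eqP.
    by have := xi0 k; rewrite negbK.
  pose f k := ComplexField.Normc.normc (xi 0 k) / x 0 k.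
  case: (@arg_maxP _ _ _ k0 predT f isT) => i _ imax.
  have fi0 : 0 < f i.
    apply: lt_le_trans (imax k0 isT); rewrite divr_gt0 // lt0r normc_ge0 andbT.
    by apply: contra xik0 => /eqP/ComplexField.Normc.eq0_normc ->.
  have nE k : ComplexField.Normc.normc (xi 0 k) = f k * x 0 k.
    by rewrite /f divfK // gt_eqF.
  rewrite -(ler_pM2r fi0) -(ler_pM2r (x0 i)).
  rewrite -mulrA -nE -ComplexField.Normc.normcM.
  have -> : mu * xi 0 i = \sum_k xi 0 k * Cr (A k i).
    move/rowP/(_ i): xiA; rewrite !mxE => <-.
    by apply: eq_bigr => k _; rewrite mxE.
  apply: (@le_trans _ _
    (\sum_k ComplexField.Normc.normc (xi 0 k * Cr (A k i)))).
    elim/big_ind2: _ => //; first by rewrite ComplexField.Normc.normc0.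
    move=> z r z' r' zr zr'.
    exact: le_trans (le_normcD _ _) (lerD zr zr').
  rewrite mulrAC -xAi mulr_suml; apply: ler_sum => k _.
  rewrite ComplexField.Normc.normcM norm_real // nE -mulrA [leRHS]mulrC.
  by apply: ler_wpM2r; [rewrite mulr_ge0 // ltW|exact: imax].
apply/eqP; rewrite eq_le; apply/andP; split.
  by apply: ge_sup => //; exists (ComplexField.Normc.normc (Cr t)), (Cr t).
apply: ub_le_sup; first by exists t.
by exists (Cr t) => //; exact: norm_real.
Qed.

Theorem irreducible_perron A :
  (0 < n)%N -> (forall i j, 0 <= A i j) -> irreducible_mx A ->
  0 < spectral_radius A /\
  exists2 x : 'rV[R]_n, (forall i, 0 < x 0 i) & x *m A = spectral_radius A *: x.
Proof.
move=> n_gt0 A0 irrA.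
have [t [x [t0 x0 xn0 xA tmin]]] := exists_minimal_subinvariant n_gt0 A0.
have xp := subinvariant_pos A0 irrA t0 x0 xn0 xA.
have {}xA := minimal_subinvariant A0 irrA t0 x0 xn0 xA tmin.
rewrite (spectral_radius_pos_eigenvector n_gt0 A0 xp xA).
split; last by exists x.
pose i := Ordinal n_gt0; have [l l1 Al] := irrA i i.
rewrite lt0r t0 andbT; apply/eqP => t_eq0.
have xAl m : x *m A ^+ m = t ^+ m *: x.
  elim: m => [|m IHm]; first by rewrite !expr0 mulmx1 scale1r.
  rewrite exprSr (_ : x *m (A ^+ m * A) = x *m A ^+ m *m A); last exact: mulmxA.
  by rewrite IHm -scalemxAl xA scalerA exprSr.
have := congr1 (fun w : 'rV[R]_n => w 0 i) (xAl l).
rewrite t_eq0 expr0n eqn0Ngt l1 scale0r !mxE (bigD1 i) //= => /eqP.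
rewrite gt_eqF // ltr_pwDl ?mulr_gt0 //.
by apply: sumr_ge0 => k _; rewrite mulr_ge0 ?(ltW (xp k)) // expmx_ge0.
Qed.

End Irreducible.

(** * The inverse correlation matrix near a regular point *)

Section Regularization.
Context {R : realType}.
Implicit Types (f g : R -> R) (t b : R).

Lemma regularized_cvg f t l : f z @[z --> t^'] --> l -> regularized f t = l.
Proof. by move=> fl; apply: cvg_lim. Qed.

Lemma regularized_continuous f t :
  {for t, continuous f} -> regularized f t = f t.
Proof. by move=> /continuous_withinNx; exact: regularized_cvg. Qed.

(** The difference quotient of [f] at [t] is [g] itself, so the continuity of
[g] at the single point [t] is enough. *)
Lemma is_derive_linear_factor f g t b :
  (\forall z \near t, f z = b + (z - t) * g z) -> {for t, continuous g} ->
  derivable f t 1 /\ derive1 f t = g t.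
Proof.
move=> fE cg; have ht : h + t @[h --> (0 : R)] --> t.
  have : h + t @[h --> (0 : R)] --> 0 + t.
    by apply: cvgD; [exact: cvg_id|exact: cvg_cst].
  by rewrite add0r.
have quot : h^-1 *: (f (h + t) - f t) @[h --> 0^'] --> g t.
  have gh : g (h + t) @[h --> 0^'] --> g t.
    apply: (@cvg_comp _ _ _ (fun h => h + t) g _ (nbhs t)) => //.
    exact: cvg_within_filter ht.
  apply: cvg_trans gh; apply: near_eq_cvg.
  have ft : f t = b by rewrite (nbhs_singleton fE) subrr mul0r addr0.
  have fE0 : \forall h \near (0 : R)^', f (h + t) = b + (h + t - t) * g (h + t).
    by have := ht _ fE; exact: nbhs_dnbhs.
  near=> h; rewrite ft (near fE0 h _) // addrK addrAC subrr add0r.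
  rewrite /GRing.scale /= mulKf //.
  by near: h; exact: nbhs_dnbhs_neq.
split; last exact: cvg_lim quot.
apply/cvg_ex; exists (g t); apply: cvg_trans quot; apply: near_eq_cvg.
by apply: nearW => h; rewrite /= [h%:A]mulr1.
Unshelve. all: by end_near. Qed.

End Regularization.

Section CorrelationInverse.
Context {R : realType} {q s : nat} (a : 'I_s -> seq 'I_q).
Hypothesis a_anti : antichain a.
Implicit Types z t : R.

Definition corr_mx_at z : 'M[R]_s :=
  map_mx (fun f : {poly R} => f.[z]) (corr_mx R a).

Lemma corr_mx_atE z i j : corr_mx_at z i j = overlap_sum z (a j) (a i).
Proof.
rewrite !mxE horner_corr // => l ij.
have -> : i = j.
  by apply: a_anti; exact: infix_trans (prefixW ij) (infix_drop _ _).
exact: leq_subr.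
Qed.

Lemma corr_inv_adj z i j : corr_mx_at z \in unitmx ->
  corr_inv a z i j = (\det (corr_mx R a)).[z]^-1 * (\adj (corr_mx R a) i j).[z].
Proof.
rewrite /corr_inv -/(corr_mx_at z) /invmx => ->; rewrite mxE.
have -> : corr_mx_at z = map_mx (horner_eval z) (corr_mx R a).
  by apply/matrixP => k l; rewrite !mxE.
by rewrite det_map_mx -map_mx_adj; congr (_ * _); rewrite mxE.
Qed.

Lemma corr_mx_at_unit z :
  (corr_mx_at z \in unitmx) = ((\det (corr_mx R a)).[z] != 0).
Proof.
rewrite unitmxE unitfE.
have -> : corr_mx_at z = map_mx (horner_eval z) (corr_mx R a).
  by apply/matrixP => k l; rewrite !mxE.
by rewrite det_map_mx.
Qed.

Lemma near_corr_mx_unit t : corr_mx_at t \in unitmx ->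
  \forall z \near t, corr_mx_at z \in unitmx.
Proof.
rewrite corr_mx_at_unit => /(cvgr_neq0 _ (continuous_horner (p := _) (x := t))).
by apply: filterS => z; rewrite corr_mx_at_unit.
Qed.

Lemma continuous_corr_inv t i j : corr_mx_at t \in unitmx ->
  {for t, continuous (fun z => corr_inv a z i j)}.
Proof.
move=> ut; have := ut; rewrite corr_mx_at_unit => dt.
rewrite /prop_for /continuous_at corr_inv_adj //.
apply: (@cvg_trans _ ((fun z => (\det (corr_mx R a)).[z]^-1 *
   (\adj (corr_mx R a) i j).[z]) @ t)).
  apply: near_eq_cvg; apply: filterS (near_corr_mx_unit ut) => z uz.
  by rewrite corr_inv_adj.
have ct (f : {poly R}) : f.[z] @[z --> t] --> f.[t].
  exact: continuous_horner.
exact: (cvgM (cvgV dt (ct _)) (ct _)).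
Qed.

Lemma continuous_row_sum t i : corr_mx_at t \in unitmx ->
  {for t, continuous (row_sum a i)}.
Proof.
move=> ut; apply: cvg_big => [|j _]; first exact: add_continuous.
exact: continuous_corr_inv.
Qed.

Lemma continuous_col_sum t j : corr_mx_at t \in unitmx ->
  {for t, continuous (col_sum a j)}.
Proof.
move=> ut; apply: cvg_big => [|i _]; first exact: add_continuous.
exact: continuous_corr_inv.
Qed.

Lemma continuous_total_sum t : corr_mx_at t \in unitmx ->
  {for t, continuous (total_sum a)}.
Proof.
move=> ut; apply: cvg_big => [|i _]; first exact: add_continuous.
exact: continuous_row_sum.
Qed.

Lemma weight_system_col_sum z : corr_mx_at z \in unitmx ->
  weight_system a z 1 (fun j => col_sum a j z).
Proof.
move=> uz k; under eq_bigr => j _ do rewrite /col_sum mulr_suml.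
rewrite exchange_big /=.
under eq_bigr => i _.
  under eq_bigr => j _ do rewrite -(corr_mx_atE z j k).
  over.
transitivity (\sum_i (corr_inv a z *m corr_mx_at z) i k).
  by apply: eq_bigr => i _; rewrite mxE.
rewrite mulVmx // (bigD1 k) //= mxE eqxx big1 ?addr0 // => i ik.
by rewrite mxE (negbTE ik).
Qed.

Lemma weight_system_row_sum z : corr_mx_at z \in unitmx ->
  weight_system (fun i => rev (a i)) z 1 (fun i => row_sum a i z).
Proof.
move=> uz k; under eq_bigr => i _ do rewrite overlap_sum_rev /row_sum mulr_suml.
rewrite exchange_big /=.
under eq_bigr => j _.
  under eq_bigr => i _ do rewrite mulrC -(corr_mx_atE z k i).
  over.
transitivity (\sum_j (corr_mx_at z *m corr_inv a z) k j).
  by apply: eq_bigr => j _; rewrite mxE.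
rewrite mulmxV // (bigD1 k) //= mxE eqxx big1 ?addr0 // => j jk.
by rewrite mxE eq_sym (negbTE jk).
Qed.

Lemma defect_col_sum z : defect (T := 'I_q) z 1 (fun j => col_sum a j z) =
  z - q%:R + total_sum a z.
Proof. by rewrite /defect card_ord mulr1 exchange_big. Qed.

Lemma defect_row_sum z : defect (T := 'I_q) z 1 (fun i => row_sum a i z) =
  z - q%:R + total_sum a z.
Proof. by rewrite /defect card_ord mulr1. Qed.

(** Where the correlation matrix is invertible the regularized values are the
values, and a word avoiding the family has no forbidden word inside it. *)
Lemma v_coord_weight t x : corr_mx_at t \in unitmx -> avoids a x ->
  v_coord a t x = weight a t 1 (fun j => col_sum a j t) x.
Proof.
move=> ut /avoidsP ax; congr (_ - _); apply: eq_bigr => j _.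
rewrite regularized_continuous; last exact: continuous_col_sum.
rewrite horner_corr // => l jx; have := ax j.
by rewrite (infix_trans (prefixW jx) (infix_drop _ _)).
Qed.

(** Since [x] is at least as long as [behead (a i)], no occurrence of [x] ends
before [behead (a i)] does; and [a i] itself is not a prefix of [x], so [a i]
and [behead (a i)] have the same overlaps with [x]. *)
Lemma u_coord_weight t x : corr_mx_at t \in unitmx -> avoids a x ->
  (forall i, a i != [::] /\ size (a i) <= (size x).+1)%N ->
  u_coord a t x =
  weight (fun i => rev (a i)) t 1 (fun i => row_sum a i t) (rev x).
Proof.
move=> ut /avoidsP ax size_ax; congr (_ - _); apply: eq_bigr => i _.
rewrite regularized_continuous; last exact: continuous_row_sum.
have [ai0 lei] := size_ax i.
rewrite horner_corr => [|l _]; last first.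
  rewrite size_behead; apply: leq_trans (leq_subr _ _) _.
  by rewrite -subn1 leq_subLR.
rewrite -overlap_sum_rev; have := ax i; case: (a i) ai0 => //= e y _ nyx.
rewrite rev_cons overlap_sum_rconsr (_ : suffix _ _ = false) ?mul0r ?addr0 //.
apply: contraNF nyx; rewrite -rev_cons => /suffixW.
by rewrite infix_rev.
Qed.

End CorrelationInverse.

(** * The Perron root *)

Section PerronRoot.
Context {R : realType} {q s : nat} (a : 'I_s -> seq 'I_q).
Hypothesis q_gt0 : (0 < q)%N.
Hypothesis s_gt0 : (0 < s)%N.
Hypothesis a_inj : injective a.
Hypothesis a_size : forall i, (2 <= size (a i))%N.
Hypothesis a_min : minimal_collection a.
Hypothesis a_irr : irreducible_mx (adjacency R a).

Local Notation N := (max_length a).-1.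
Local Notation A := (adjacency R a).
Local Notation theta := (spectral_radius A).
Local Notation ra := (fun i => rev (a i)).
Let a_neq0 := forbidden_neq0 a_size.
Let a_anti : antichain a := minimal_antichain a_inj a_min.
Let n_gt0 : (0 < nstates a)%N := nstates_gt0 s_gt0 a_size a_min.
Let adj_mul := adjacency_weight (R := R) q_gt0 s_gt0 a_inj a_size a_min.
Let adj_mul_rev := adjacency_weight_rev (R := R) q_gt0 s_gt0 a_inj a_size a_min.

Lemma adjacency_ge0 i j : 0 <= A i j.
Proof. by rewrite mxE ler0n. Qed.

(** Pairing [adjacency_weight] with a positive left eigenvector of [A] leaves
the defect times a positive number. *)
Lemma defect_spectral_radius d (c : 'I_s -> R) :
  weight_system a theta d c -> defect (T := 'I_q) theta d c = 0.
Proof.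
move=> /adj_mul /= AV.
have [_ [x x0 xA]] := irreducible_perron n_gt0 adjacency_ge0 a_irr.
have /eqP := congr1 (mulmx x) AV.
rewrite mulmxA xA mulmxBr -scalemxAl -scalemxAr -subr_eq0 opprB addrC subrK.
move=> /eqP/matrixP/(_ 0 0); rewrite !mxE.
under eq_bigr => k _ do rewrite mxE.
rewrite -mulr_suml => /eqP; rewrite mulf_eq0 => /orP[|/eqP //].
rewrite gt_eqF // (bigD1 (Ordinal n_gt0)) //= ltr_pwDl //.
by apply: sumr_ge0 => k _; exact: ltW.
Qed.

Lemma weight_eigenvector d (c : 'I_s -> R) : weight_system a theta d c ->
  let V := \col_(i < nstates a) weight a theta d c (state i) in
  A *m V = theta *: V.
Proof.
move=> sys V; rewrite adj_mul // defect_spectral_radius //.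
by rewrite (_ : const_mx 0 = 0) ?subr0 //; apply/matrixP => i j; rewrite !mxE.
Qed.

(** A row vector [w] with [w *m corr_mx_at a theta = 0] is a weight system with
[d = 0]. Its weights form an eigenvector whose entries sum to zero; as
eigenvectors for [theta] have constant sign, all weights of states vanish, and
[weight_eq0] gives [w = 0]. *)
Lemma corr_mx_unit_spectral_radius : corr_mx_at a theta \in unitmx.
Proof.
have [theta_gt0 [x x0 xA]] := irreducible_perron n_gt0 adjacency_ge0 a_irr.
rewrite -row_free_unit -kermx_eq0; apply: contraT.
move=> /rowV0Pn[w /sub_kermxP wM w0].
pose c j := w 0 j; have sys : weight_system a theta 0 c.
  move=> k; move/rowP/(_ k): wM; rewrite !mxE => wMk; rewrite -[RHS]wMk.
  by apply: eq_bigr => j _; rewrite corr_mx_atE.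
have dft := defect_spectral_radius sys.
pose V := \col_(i < nstates a) weight a theta 0 c (state i).
have VE i : V i 0 = weight a theta 0 c (state i) by rewrite mxE.
have sumV : \sum_i V i 0 = 0.
  under eq_bigr => i _ do rewrite VE.
  by rewrite (sum_state_weight q_gt0 a_inj a_size a_min sys dft) mulr0.
have V0 : V = 0.
  have [//|[Vp|Vn]] := perron_eigenvector_sign adjacency_ge0 a_irr x0 xA
    (ltW theta_gt0) (weight_eigenvector sys).
    move: sumV; rewrite (bigD1 (Ordinal n_gt0)) //= => /eqP.
    rewrite gt_eqF // ltr_pwDl //; apply: sumr_ge0 => i _; exact: ltW (Vp i).
  move: sumV; rewrite (bigD1 (Ordinal n_gt0)) //= => /eqP.
  rewrite lt_eqF // ltr_wnDr ?(Vn (Ordinal n_gt0)) //.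
  by apply: sumr_le0 => i _; exact: ltW (Vn i).
case/eqP: w0; apply/rowP => k; rewrite [RHS]mxE.
apply: (weight_eq0 a_neq0 a_anti sys dft (n := N)).
- by rewrite gt_eqF.
- by move=> j; rewrite -!subn1 leq_sub2r // size_le_max_length.
move=> y sy ay; have syb : size y == N by apply/eqP.
have [i iy] : exists i : 'I_(nstates a), state i = Tuple syb.
  by apply: state_surj; exact: avoids_allowed.
by have := VE i; rewrite V0 mxE iy.
Qed.

Let theta_unit := corr_mx_unit_spectral_radius.
Let col_sys := weight_system_col_sum a_anti theta_unit.
Let row_sys := weight_system_row_sum a_anti theta_unit.

Lemma v_vecE i : v_vec a theta i 0 =
  weight a theta 1 (fun j => col_sum a j theta) (state i).
Proof.
rewrite mxE v_coord_weight //; exact: (state_avoids q_gt0 a_size a_min).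
Qed.

Lemma u_vecE i : u_vec a theta i 0 =
  weight ra theta 1 (fun j => row_sum a j theta) (rev (state i)).
Proof.
rewrite mxE u_coord_weight // => [|j].
  exact: (state_avoids q_gt0 a_size a_min).
by rewrite a_neq0 (size_forbidden_state s_gt0 a_size).
Qed.

(** The entries of the eigenvector sum to a power of [theta], so their constant
sign is positive. *)
Lemma right_perron_v_vec : right_perron_vector A (v_vec a theta).
Proof.
have [theta_gt0 [x x0 xA]] := irreducible_perron n_gt0 adjacency_ge0 a_irr.
have Av : A *m v_vec a theta = theta *: v_vec a theta.
  have := weight_eigenvector col_sys; congr (A *m _ = _ *: _);
    by apply/colP => i; rewrite v_vecE mxE.
split=> //.
have sumv : 0 < \sum_i v_vec a theta i 0.
  under eq_bigr => i _ do rewrite v_vecE.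
  rewrite (sum_state_weight q_gt0 a_inj a_size a_min col_sys) ?mulr1.
    exact: exprn_gt0.
  exact: defect_spectral_radius.
have [v0|[//|vn]] := perron_eigenvector_sign adjacency_ge0 a_irr x0 xA
  (ltW theta_gt0) Av.
  by move: sumv; rewrite v0 big1 ?ltxx // => i _; rewrite mxE.
move: sumv; rewrite ltNge => /negP; case.
by apply: sumr_le0 => i _; exact: ltW (vn i).
Qed.

Lemma sum_u_vec : \sum_i u_vec a theta i 0 = theta ^+ N.
Proof.
under eq_bigr => i _ do rewrite u_vecE.
rewrite (sum_state_weight_rev q_gt0 a_inj a_size a_min row_sys) ?mulr1 //.
by rewrite defect_row_sum -defect_col_sum; exact: defect_spectral_radius.
Qed.

(** Same argument for the transposed matrix, with [v_vec a theta] as the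
positive left eigenvector. *)
Lemma left_perron_u_vec : left_perron_vector A (u_vec a theta).
Proof.
have [theta_gt0 _] := irreducible_perron n_gt0 adjacency_ge0 a_irr.
have [Av v_gt0] := right_perron_v_vec.
have uA : (u_vec a theta)^T *m A = theta *: (u_vec a theta)^T.
  have := adj_mul_rev row_sys; rewrite defect_row_sum -defect_col_sum.
  rewrite defect_spectral_radius // (_ : const_mx 0 = 0); last first.
    by apply/matrixP => i j; rewrite !mxE.
  rewrite /= subr0; congr (_^T *m A = _ *: _^T);
    by apply/colP => i; rewrite u_vecE mxE.
split=> //.
have Atu : A^T *m u_vec a theta = theta *: u_vec a theta.
  by rewrite -[u_vec a theta in LHS]trmxK -trmx_mul uA linearZ /= trmxK.
have vAt : (v_vec a theta)^T *m A^T = theta *: (v_vec a theta)^T.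
  by rewrite -trmx_mul Av linearZ.
have At0 i j : 0 <= A^T i j by rewrite mxE adjacency_ge0.
have vt0 i : 0 < (v_vec a theta)^T 0 i by rewrite mxE.
have [u0|[//|un]] := perron_eigenvector_sign At0 (irreducible_tr a_irr) vt0 vAt
  (ltW theta_gt0) Atu.
  have := sum_u_vec; rewrite u0 big1 => [/esym/eqP|i _]; last by rewrite mxE.
  by rewrite expf_eq0 gt_eqF // andbF.
have : 0 < \sum_i u_vec a theta i 0 by rewrite sum_u_vec exprn_gt0.
rewrite ltNge => /negP; case.
by apply: sumr_le0 => i _; exact: ltW (un i).
Qed.

(** The pairing of the fixed left eigenvector with the moving vector V(z),
normalized so that [z - theta] times it is z - q + r(z). *)
Let g z := (\sum_i u_vec a theta i 0 *
  weight a z 1 (fun j => col_sum a j z) (state i)) / theta ^+ N.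

Lemma continuous_pairing : {for theta, continuous g}.
Proof.
have cC (r : R) : {for theta, continuous (fun _ : R => r)}.
  exact: cst_continuous.
have cM (f h : R -> R) : {for theta, continuous f} ->
    {for theta, continuous h} -> {for theta, continuous (fun z => f z * h z)}.
  exact: continuousM.
have cB (f h : R -> R) : {for theta, continuous f} ->
    {for theta, continuous h} -> {for theta, continuous (fun z => f z - h z)}.
  exact: continuousB.
have cS k (f : 'I_k -> R -> R) : (forall i, {for theta, continuous (f i)}) ->
    {for theta, continuous (fun z => \sum_(i < k) f i z)}.
  by move=> cf; apply: cvg_big => [|i _]; [exact: add_continuous|exact: cf].
apply: (cM) => //; apply: (cS) => i; apply: (cM) => //.
apply: (cB (fun=> 1)) => //; apply: (cS) => j; apply: (cM).
  exact: continuous_col_sum.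
by apply: cS => m; apply: cM => //; exact: exprn_continuous.
Qed.

(** Pair [adjacency_weight] at [z] with the left eigenvector at [theta], whose
entries sum to [theta ^+ N]. *)
Lemma near_total_sum : \forall z \near theta,
  total_sum a z = q%:R - z + (z - theta) * g z.
Proof.
apply: filterS (near_corr_mx_unit theta_unit) => z uz.
have [theta_gt0 _] := irreducible_perron n_gt0 adjacency_ge0 a_irr.
have [uA _] := left_perron_u_vec.
have /= := adj_mul (weight_system_col_sum a_anti uz).
set V := \col_i _ => /(congr1 (mulmx (u_vec a theta)^T)).
rewrite mulmxA uA mulmxBr -scalemxAl -scalemxAr.
move=> /matrixP/(_ 0 0); rewrite mxE [RHS]mxE.
rewrite [X in _ = X + _]mxE [X in _ = _ + X]mxE.
set uV := (_ *m V) 0 0; rewrite [X in _ - X]mxE defect_col_sum.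
under [X in _ - X]eq_bigr => i _ do rewrite mxE [const_mx _ _ _]mxE.
rewrite -mulr_suml sum_u_vec => E.
have gE : g z * theta ^+ N = uV.
  rewrite /g divfK ?expf_neq0 ?gt_eqF // /uV mxE; apply: eq_bigr => i _.
  by rewrite [_^T _ _]mxE [V _ _]mxE.
have tN0 : theta ^+ N != 0 by rewrite expf_neq0 // gt_eqF.
apply: (mulfI tN0); move: E; rewrite -gE => E.
by ring: E.
Qed.

Lemma near_regularized_total_sum : \forall z \near theta,
  regularized (total_sum a) z = q%:R - theta + (z - theta) * (g z - 1).
Proof.
apply: filterS2 (near_corr_mx_unit theta_unit) near_total_sum => z uz zE.
rewrite regularized_continuous.
  by rewrite zE; ring.
exact: continuous_total_sum.
Qed.

Lemma derive_regularized_total_sum :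
  derivable (regularized (total_sum a)) theta 1 /\
  ((u_vec a theta)^T *m v_vec a theta) 0 0 =
  theta ^+ N * (1 + derive1 (regularized (total_sum a)) theta).
Proof.
have [theta_gt0 _] := irreducible_perron n_gt0 adjacency_ge0 a_irr.
have [|dr ->] := is_derive_linear_factor near_regularized_total_sum.
  by apply: (continuousB continuous_pairing); exact: cst_continuous.
split=> //; rewrite addrC subrK /g mulrC divfK; last first.
  by rewrite expf_neq0 // gt_eqF.
by rewrite mxE; apply: eq_bigr => i _; rewrite v_vecE mxE.
Qed.

End PerronRoot.

Theorem theorem2 (R : realType) (q s : nat) (a : 'I_s -> seq 'I_q)
    (hq : (2 <= q)%N)
    (hs : (0 < s)%N)
    (a_inj : injective a)
    (a_size : forall i : 'I_s, (2 <= size (a i))%N)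
    (a_min : minimal_collection a)
    (a_irr : irreducible_mx (adjacency R a)) :
  let p := max_length a in
  let A := adjacency R a in
  let theta := spectral_radius A in
  let u := u_vec a theta in
  let v := v_vec a theta in
  [/\ (* the limits defining R_i(theta) and C_j(theta) exist *)
      (forall i : 'I_s, cvg (row_sum a i z @[z --> theta^'])) /\
      (forall j : 'I_s, cvg (col_sum a j z @[z --> theta^'])),
      forall x : p.-1.-tuple 'I_q, allowed a x ->
        0 < u_coord a theta x * v_coord a theta x,
      right_perron_vector A v,
      left_perron_vector A u &
      1 < theta ->
        derivable (regularized (total_sum a)) theta 1 /\
        (u^T *m v) 0 0 =
          theta ^+ p.-1 * (1 + derive1 (regularized (total_sum a)) theta)].
Proof.
have q_gt0 : (0 < q)%N by exact: ltnW.
have theta_unit :=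
  corr_mx_unit_spectral_radius q_gt0 hs a_inj a_size a_min a_irr.
have v_perron := right_perron_v_vec q_gt0 hs a_inj a_size a_min a_irr.
have u_perron := left_perron_u_vec q_gt0 hs a_inj a_size a_min a_irr.
split=> //.
- split=> i.
    by apply: cvgP; apply/continuous_withinNx/continuous_row_sum.
  by apply: cvgP; apply/continuous_withinNx/continuous_col_sum.
- move=> x /state_surj[i <-].
  have := u_perron.2 i; have := v_perron.2 i; rewrite !mxE => v0 u0.
  exact: mulr_gt0.
by move=> _; exact: derive_regularized_total_sum.
Qed.
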